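(* Suppose $(x^*,u^* )\in\mathbb{R}^n\times\mathbb{R}^m$ is a local optimal solution of the problem (P), and let $\mathcal I_-^* := \{i\in[m] : u_i^*\le 0\}$. The following hold. (i) $(x^*,u^* )$ is also a local minimum of the smooth problem (S): $\min_{x,u} f(x)$ subject to $u_{\mathcal I_-^*}\le 0$, $Ax+b=u$. (ii) There exists a Lagrange multiplier $y^*\in\mathbb{R}^m$ such that $(x^*,u^*,y^* )$ is a KKT point of (P). Consequently, $(x^*,u^* )$ is a P-stationary point of (P) with any $\alpha\in(0,\alpha^* )$, where $\alpha^*=\min\{\alpha_u^*,\alpha_y^*\}$ and $$\alpha_u^* := \begin{cases} +\infty, & u^*\le 0,\\ \min\left\{\frac{(u_i^* )^2}{2\lambda} : u_i^*>0\right\}, & \text{otherwise},\end{cases}\qquad \alpha_y^* := \begin{cases} +\infty, & y^*\le 0,\\ \min\left\{\frac{2\lambda}{(y_i^* )^2} : y_i^*>0\right\}, & \text{otherwise}.\end{cases}$$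
   Context: $[m]=\{1,\dots,m\}$; for $T\subseteq[m]$, $u_T$ is the subvector of $u$ indexed by $T$; vector inequalities are componentwise. $f:\mathbb{R}^n\to\mathbb{R}$ is smooth (continuously differentiable), $\lambda>0$, $A\in\mathbb{R}^{m\times n}$, $b\in\mathbb{R}^m$, and $h(u):=\|u_+\|_0$ is the number of strictly positive entries of $u\in\mathbb{R}^m$. No rank assumption is made on $A$. Problem (P): $\min_{x\in\mathbb{R}^n,u\in\mathbb{R}^m} f(x)+\lambda h(u)$ subject to $Ax+b=u$. KKT point of (P): a triple $(x,u,y)$ with $\nabla f(x)+A^\top y=0$, $y\in\lambda\,\partial h(u)$, $Ax+b-u=0$, where $\partial h$ is the limiting subdifferential, which is given by $\partial h(u)=\{v\in\mathbb{R}^m : v_i\ge 0 \text{ if } u_i=0,\ v_i=0 \text{ if } u_i\ne 0\}$. For $\alpha>0$, $\mathrm{Prox}_{\alpha\lambda h(\cdot)}(v):=\arg\min_{z\in\mathbb{R}^m}\{\alpha\lambda h(z)+\tfrac12\|z-v\|^2\}$ (set-valued). $(x,u)$ is a P-stationary point of (P) with $\alpha>0$ and P-stationary multiplier $y$ if $\nabla f(x)+A^\top y=0$, $u\in\mathrm{Prox}_{\alpha\lambda h(\cdot)}(u+\alpha y)$, and $Ax+b-u=0$; in (ii) the multiplier is the $y^*$ given there. *)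

(* Defs.v *)
From HB Require Import structures.
From mathcomp Require Import all_boot all_order all_algebra.
From mathcomp Require Import all_classical all_reals all_analysis.

Set Implicit Arguments.
Unset Strict Implicit.
Unset Printing Implicit Defensive.

Import Order.TTheory GRing.Theory Num.Theory.
Import numFieldNormedType.Exports.

Local Open Scope classical_set_scope.
Local Open Scope ring_scope.

(* Vectors of R^k are column vectors, so [v i 0] is the i-th coordinate of [v];
   the index set {1, ..., m} is 'I_m. *)

Section Vectors.
Context {R : realType}.

Definition dotcv k (v w : 'cV[R]_k) : R := \sum_i v i 0 * w i 0.

(* The norm `|v| of the library is the sup norm; this is the Euclidean one. *)
Definition enorm k (v : 'cV[R]_k) : R := Num.sqrt (dotcv v v).

Definition poscv k (v : 'cV[R]_k) : 'cV[R]_k := \col_i Num.max (v i 0) 0.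

Definition l0norm k (v : 'cV[R]_k) : nat := #|[set i | v i 0 != 0]%SET|.

Definition hpos k (u : 'cV[R]_k) : R := (l0norm (poscv u))%:R.

End Vectors.

Section Differentiation.
Context {R : realType}.

Definition grad k (f : 'cV[R]_k -> R) (x : 'cV[R]_k) : 'cV[R]_k :=
  \col_i ('D_(delta_mx i 0) f x : R).

Definition continuously_differentiable k (f : 'cV[R]_k -> R) : Prop :=
  (forall x, differentiable f x) /\ continuous (grad f).

(* Regular (Frechet) subgradients: the o(|z - u|) form, with its quantifiers
   written out. *)
Definition regular_subdiff k (g : 'cV[R]_k -> R) (u : 'cV[R]_k) :
    set 'cV[R]_k :=
  [set v | forall e : R, 0 < e ->
     \forall z \near u, g u + dotcv v (z - u) - e * enorm (z - u) <= g z].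

(* Limiting (Mordukhovich) subgradients. *)
Definition limiting_subdiff k (g : 'cV[R]_k -> R) (u : 'cV[R]_k) :
    set 'cV[R]_k :=
  [set v | exists (us vs : nat -> 'cV[R]_k),
     [/\ us j @[j --> \oo] --> u,
         g (us j) @[j --> \oo] --> g u,
         (forall j, regular_subdiff g (us j) (vs j)) &
         vs j @[j --> \oo] --> v]].

End Differentiation.

Section Optimization.
Context {R : realType}.

Definition local_minimizer (T : topologicalType) (D : set T) (F : T -> R)
    (z : T) : Prop :=
  D z /\ \forall w \near z, D w -> F z <= F w.

Definition argmin (T : Type) (F : T -> R) : set T :=
  [set z | forall w, F z <= F w].

Definition prox k (a : R) (g : 'cV[R]_k -> R) (v : 'cV[R]_k) : set 'cV[R]_k :=
  argmin (fun z => a * g z + 2^-1 * enorm (z - v) ^+ 2).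

End Optimization.

Section Problem.
Context {R : realType} {n m : nat}.
Implicit Types (f : 'cV[R]_n -> R) (lambda alpha : R) (A : 'M[R]_(m, n)).
Implicit Types (b u y : 'cV[R]_m) (x : 'cV[R]_n).

Definition P_feasible A b : set ('cV[R]_n * 'cV[R]_m) :=
  [set p | A *m p.1 + b = p.2].

Definition P_objective f lambda (p : 'cV[R]_n * 'cV[R]_m) : R :=
  f p.1 + lambda * hpos p.2.

Definition nonpos_index u : {set 'I_m} := [set i | u i 0 <= 0]%SET.

Definition S_feasible A b (I : {set 'I_m}) : set ('cV[R]_n * 'cV[R]_m) :=
  [set p : 'cV[R]_n * 'cV[R]_m |
     (forall i, i \in I -> p.2 i 0 <= 0) /\ A *m p.1 + b = p.2].

Definition S_objective f (p : 'cV[R]_n * 'cV[R]_m) : R := f p.1.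

Definition KKT_point f lambda A b x u y : Prop :=
  [/\ grad f x + A^T *m y = 0,
      [set lambda *: v | v in limiting_subdiff (@hpos R m) u] y &
      A *m x + b - u = 0].

Definition P_stationary f lambda A b alpha x u y : Prop :=
  [/\ grad f x + A^T *m y = 0,
      prox (alpha * lambda) (@hpos R m) (u + alpha *: y) u &
      A *m x + b - u = 0].

(* The thresholds are extended reals; a minimum over no index would be +oo. *)
Definition alpha_u lambda u : \bar R :=
  if [forall i, u i 0 <= 0] then +oo%E
  else \big[Order.min/+oo%E]_(i | 0 < u i 0) ((u i 0) ^+ 2 / (2 * lambda))%:E.

Definition alpha_y lambda y : \bar R :=
  if [forall i, y i 0 <= 0] then +oo%E
  else \big[Order.min/+oo%E]_(i | 0 < y i 0) ((2 * lambda) / (y i 0) ^+ 2)%:E.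

Definition alpha_star lambda u y : \bar R :=
  Order.min (alpha_u lambda u) (alpha_y lambda y).

End Problem.

(* Main.v *)
(** A point feasible for (S) has no more positive entries than [us], so local
    optimality for (P) passes to (S).  The constraints of (S) being affine, no
    qualification is needed: moving along any [d] with [(A d)_i <= 0] for all
    active [i] stays feasible for small steps, so [grad f . d >= 0], and Farkas'
    lemma yields a nonnegative multiplier supported on the active set
    [us_i = 0].  Both the KKT inclusion and the proximal inequality then split
    into one-dimensional inequalities for the step function. *)
Require Import Defs.
From mathcomp Require Import all_boot all_order all_algebra.
From mathcomp Require Import all_classical all_reals all_analysis.
From mathcomp Require Import lra.

Set Implicit Arguments.
Unset Strict Implicit.
Unset Printing Implicit Defensive.

Import Order.TTheory GRing.Theory Num.Theory.
Import numFieldNormedType.Exports.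

Local Open Scope classical_set_scope.
Local Open Scope ring_scope.

(** * The Euclidean inner product and Farkas' lemma *)

Lemma dotcvDl (R : realType) k (v w z : 'cV[R]_k) :
  dotcv (v + w) z = dotcv v z + dotcv w z.
Proof. by rewrite -big_split; apply: eq_bigr => i _; rewrite !mxE mulrDl. Qed.

Lemma dotcvC (R : realType) k (v w : 'cV[R]_k) : dotcv v w = dotcv w v.
Proof. by apply: eq_bigr => i _; rewrite mulrC. Qed.

Lemma dotcvZl (R : realType) k c (v z : 'cV[R]_k) :
  dotcv (c *: v) z = c * dotcv v z.
Proof. by rewrite mulr_sumr; apply: eq_bigr => i _; rewrite !mxE mulrA. Qed.

Lemma dotcvBl (R : realType) k (v w z : 'cV[R]_k) :
  dotcv (v - w) z = dotcv v z - dotcv w z.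
Proof. by rewrite -scaleN1r dotcvDl dotcvZl mulN1r. Qed.

Lemma dotcvBr (R : realType) k (v w z : 'cV[R]_k) :
  dotcv z (v - w) = dotcv z v - dotcv z w.
Proof. by rewrite !(dotcvC z) dotcvBl. Qed.

Lemma dotcvZr (R : realType) k c (v z : 'cV[R]_k) :
  dotcv z (c *: v) = c * dotcv z v.
Proof. by rewrite !(dotcvC z) dotcvZl. Qed.

Lemma dotcv_ge0 (R : realType) k (v : 'cV[R]_k) : 0 <= dotcv v v.
Proof. by apply: sumr_ge0 => i _; rewrite -expr2 sqr_ge0. Qed.

Lemma dotcv_eq0 (R : realType) k (v : 'cV[R]_k) : dotcv v v = 0 -> v = 0.
Proof.
move=> /eqP; rewrite psumr_eq0 => [|i _]; last by rewrite -expr2 sqr_ge0.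
move=> /allP v0; apply/colP => i; rewrite mxE.
by have := v0 i (mem_index_enum i); rewrite mulf_eq0 orbb => /eqP.
Qed.

Lemma sqr_enorm (R : realType) k (v : 'cV[R]_k) :
  enorm v ^+ 2 = \sum_i v i 0 ^+ 2.
Proof. by rewrite sqr_sqrtr ?dotcv_ge0. Qed.

(* Bartl's algebraic proof: when the conclusion fails without the head
   constraint [a i], a witness [d1] normalised by [a i . d1 = 1] lets one
   eliminate [a i] from all the other vectors. *)
Lemma farkas (R : realType) n (I : finType) (s : seq I) (a : I -> 'cV[R]_n)
    (c : 'cV[R]_n) :
  (forall d, (forall i, i \in s -> dotcv (a i) d <= 0) -> dotcv c d <= 0) ->
  exists y : I -> R, [/\ forall i, 0 <= y i, forall i, i \notin s -> y i = 0 &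
    c = \sum_i y i *: a i].
Proof.
elim: s a c => [|i s IHs] a c H.
  exists (fun=> 0); split=> //; rewrite big1 => [|j _]; last by rewrite scale0r.
  by apply: dotcv_eq0; apply/eqP; rewrite eq_le dotcv_ge0 H.
have [Hs|/existsNP[d0 /not_implyP[Hd0 /negP]]] := pselect (forall d,
    (forall j, j \in s -> dotcv (a j) d <= 0) -> dotcv c d <= 0).
  have [y [y0 yN yE]] := IHs a c Hs; exists y; split=> // j.
  by rewrite inE negb_or => /andP[_ /yN].
rewrite -ltNge => cd0.
have ad0 : 0 < dotcv (a i) d0.
  rewrite ltNge; apply/negP => ad0.
  suff : dotcv c d0 <= 0 by rewrite leNgt cd0.
  by apply: H => j; rewrite inE => /predU1P[->|/Hd0].
set d1 := (dotcv (a i) d0)^-1 *: d0.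
have ad1 : dotcv (a i) d1 = 1 by rewrite dotcvZr mulVf ?gt_eqF.
have cd1 : 0 < dotcv c d1 by rewrite dotcvZr mulr_gt0 ?invr_gt0.
have Hd1 j : j \in s -> dotcv (a j) d1 <= 0.
  by move=> /Hd0 ?; rewrite dotcvZr pmulr_rle0 ?invr_gt0.
clearbody d1.
(* [p] projects along [a i] onto the orthogonal complement of [d1]. By [pE] its adjoint sends [d] to
   a vector orthogonal to [a i], so the head constraint holds there with equality and the induction
   hypothesis applies to the projected vectors. *)
pose p (v : 'cV[R]_n) : 'cV[R]_n := v - dotcv v d1 *: a i.
have pE v d : dotcv (p v) d = dotcv v (d - dotcv (a i) d *: d1).
  by rewrite /p dotcvBl dotcvZl dotcvBr dotcvZr mulrC.
have [d Hd|y [y0 yN yE]] := IHs (fun j => p (a j)) (p c).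
  rewrite pE; apply: H => j; rewrite inE => /predU1P[->|/Hd /=].
    by rewrite dotcvBr dotcvZr ad1 mulr1 subrr.
  by rewrite pE.
(* Undoing the projections in [yE] leaves exactly [t] as the coefficient of [a i]. It is nonnegative
   because [c] is positive on [d1] while every [a j] with [j] in [s] is nonpositive there. *)
pose t := dotcv c d1 - \sum_j y j * dotcv (a j) d1.
have t0 : 0 <= t.
  rewrite subr_ge0 (le_trans _ (ltW cd1))// -oppr_ge0 -sumrN sumr_ge0// => j _.
  have [/Hd1 js|/yN->] := boolP (j \in s); last by rewrite mul0r oppr0.
  by rewrite -mulrN mulr_ge0// oppr_ge0.
(* The coefficient is added rather than overwritten: [i] may occur again in [s], with [y i]
   nonzero. *)
exists (fun j => y j + (j == i)%:R * t); split=> [j|j|].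
- by rewrite addr_ge0// mulr_ge0.
- by rewrite inE negb_or => /andP[/negPf-> /yN->]; rewrite mul0r addr0.
under eq_bigr => j _ do rewrite scalerDl.
rewrite big_split /= [X in _ + X](bigD1 i)//= [X in _ + (_ + X)]big1.
  rewrite eqxx mul1r addr0; move/eqP: yE; rewrite subr_eq => /eqP->.
  under [in LHS]eq_bigr => j _ do rewrite scalerBr scalerA.
  rewrite sumrB -scaler_suml /t scalerBl.
  by rewrite -addrA; congr (_ + _); rewrite addrC.
by move=> j /negPf->; rewrite mul0r scale0r.
Qed.

(** * Counting positive entries; directional derivatives *)

Lemma hposE (R : realType) k (u : 'cV[R]_k) :
  hpos u = \sum_i (0 < u i 0)%R%:R.
Proof.
rewrite /hpos /l0norm -sum1_card natr_sum big_mkcond; apply: eq_bigr => i _.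
rewrite inE mxE /Num.max; case: ltP => u0; first by rewrite eqxx; case: ltgtP u0.
by case: ltgtP u0.
Qed.

(** [grad] only records derivatives along basis vectors; linearity of the differential extends the
    formula to every direction. *)
Lemma derive_dotcv (R : realType) n (f : 'cV[R]_n -> R) x d :
  differentiable f x -> 'D_d f x = dotcv (grad f x) d.
Proof.
move=> df; rewrite deriveE// [in LHS](matrix_sum_delta d) linear_sum.
apply: eq_bigr => i _; rewrite big_ord1 linearZ /= mxE deriveE//.
by rewrite mulrC.
Qed.

Lemma cvg_line (R : realType) n (x d : 'cV[R]_n) :
  (h *: d + x) @[h --> (0 : R)] --> x.
Proof.
rewrite -[X in _ --> X]add0r -(scale0r d); apply: cvgD; last exact: cvg_cst.
by apply: cvgZr_tmp.
Qed.

Lemma cvg_coord (R : realType) k (u : 'cV[R]_k) i : z i 0 @[z --> u] --> u i 0.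
Proof. exact: coord_continuous. Qed.

Arguments cvg_line {R n} x d.

(** * The smooth problem (S) and its multiplier *)

Lemma local_minimizer_S (R : realType) n m (f : 'cV[R]_n -> R) lambda
    (A : 'M[R]_(m, n)) b x u : 0 < lambda ->
  local_minimizer (P_feasible A b) (P_objective f lambda) (x, u) ->
  local_minimizer (S_feasible A b (nonpos_index u)) (S_objective f) (x, u).
Proof.
move=> lambda_gt0 [feas opt]; split.
  by split=> // i; rewrite inE.
apply: filterS opt => -[x' u'] /= opt [u'_le0 feas'].
have := opt feas'; rewrite /P_objective /S_objective /= !hposE.
suff : \sum_i (0 < u' i 0)%R%:R <= \sum_i (0 < u i 0)%R%:R :> R.
  rewrite -(ler_pM2l lambda_gt0); lra.
apply: ler_sum => i _; rewrite ler_nat; case: (ltP 0 (u i 0)) => [_|ui].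
  exact: leq_b1.
by rewrite ltNge u'_le0// inE.
Qed.

Lemma multiplier_S (R : realType) n m (f : 'cV[R]_n -> R)
    (A : 'M[R]_(m, n)) b x u : differentiable f x ->
  local_minimizer (S_feasible A b (nonpos_index u)) (S_objective f) (x, u) ->
  exists y : 'cV[R]_m, [/\ forall i, 0 <= y i 0,
    forall i, u i 0 != 0 -> y i 0 = 0 & grad f x + A^T *m y = 0].
Proof.
move=> df [[_ /= feas] opt].
have dotA i d : dotcv (row i A)^T d = (A *m d) i 0.
  by rewrite mxE; apply: eq_bigr => j _; rewrite !mxE.
have descent d : (forall i, i \in enum [pred i | u i 0 == 0] ->
    dotcv (row i A)^T d <= 0) -> dotcv (- grad f x) d <= 0.
  move=> Hd; rewrite -scaleN1r dotcvZl mulN1r oppr_le0 -derive_dotcv//.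
  (* The derivative is also the limit of the quotients over [h > 0], so their nonnegativity for
     small positive [h] suffices. *)
  have /cvg_dnbhs_at_right der : h^-1 *: ((f \o shift x) (h *: d) - f x)
      @[h --> 0^'] --> 'D_d f x by exact: diff_derivable.
  rewrite -(cvg_lim _ der)//; apply: limr_ge.
    by apply/cvg_ex; eexists; exact: der.
  (* Moving [u] along [A *m d] keeps the equality constraint along the whole line. *)
  have cvg_xu : (h *: d + x, h *: (A *m d) + u) @[h --> (0 : R)^'+] --> (x, u).
    exact: cvg_pair (cvg_at_right_filter (cvg_line x d))
      (cvg_at_right_filter (cvg_line u (A *m d))).
  have {}opt : \forall h \near (0 : R)^'+,
      S_feasible A b (nonpos_index u) (h *: d + x, h *: (A *m d) + u) ->
      f x <= f (h *: d + x) by exact: cvg_xu opt.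
  (* Only strictly negative entries require a small [h]: entries with [u i 0 = 0] stay nonpositive
     by the choice of [d], and positive ones are unconstrained in (S). *)
  have neg : \forall h \near (0 : R)^'+, forall i, u i 0 < 0 ->
      h * (A *m d) i 0 + u i 0 <= 0.
    apply: filter_forall => i; case: (ltP (u i 0) 0) => ui; last exact: nearW.
    have cvg_i : (h *: (A *m d) + u) i 0 @[h --> (0 : R)^'+] --> u i 0.
      apply: (cvg_comp (fun h => h *: (A *m d) + u) (fun z => z i 0)
        (cvg_at_right_filter (cvg_line u (A *m d)))).
      exact: cvg_coord.
    by apply: filterS (cvgr_le _ cvg_i _ ui) => h; rewrite !mxE => ->.
  near=> h.
  have h0 : 0 < h by near: h; exact: nbhs_right_gt.
  rewrite /= /GRing.scale /= mulr_ge0 ?invr_ge0 ?(ltW h0)// subr_ge0.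
  have := near opt h; apply=> //; split=> /= [i|].
    suff : u i 0 <= 0 -> h * (A *m d) i 0 + u i 0 <= 0 by rewrite inE !mxE.
    rewrite le_eqVlt => /predU1P[ui0|ui].
      rewrite ui0 addr0 pmulr_rle0//.
      by have := Hd i; rewrite dotA; apply; rewrite mem_enum inE ui0.
    by have := near neg h; exact.
  by rewrite mulmxDr -scalemxAr -feas addrA.
have [y [y0 yN yE]] := farkas descent.
exists (\col_i y i); split=> [i|i ui|].
- by rewrite mxE.
- by rewrite mxE yN// mem_enum inE.
rewrite -[grad f x]opprK yE; apply/eqP; rewrite addrC subr_eq0; apply/eqP/colP => j.
by rewrite mxE summxE; apply: eq_bigr => i _; rewrite !mxE mulrC.
Unshelve. all: by end_near. Qed.

(** * Subgradients of the counting function *)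

Lemma near_step_subgradient (R : realType) (u v : R) :
  0 <= v -> (u != 0 -> v = 0) ->
  \forall z \near u, (0 < u)%R%:R + v * (z - u) <= (0 < z)%R%:R.
Proof.
move=> v0 vN; have [u_lt0|u_gt0|u0] := ltgtP u 0.
- by near=> z; rewrite vN ?lt_eqF// mul0r addr0.
- near=> z; rewrite vN ?gt_eqF// mul0r addr0.
  have -> // : 0 < z by near: z; exact: lt_nbhsr.
(* At the jump any slope [v >= 0] works: for [z > 0] near 0 the unit jump exceeds [v * z], and for
   [z <= 0] the linear term is nonpositive. *)
- have cvg_v : v * z @[z --> u] --> v * u.
    by apply: cvgM; [exact: cvg_cst|exact: cvg_id].
  rewrite {2}u0 mulr0 in cvg_v.
  near=> z; rewrite add0r u0 subr0; case: ltP => [_|z_le0].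
    by near: z; exact: cvgr_le cvg_v _ ltr01.
  by rewrite mulr_ge0_le0.
Unshelve. all: by end_near. Qed.

Lemma regular_subdiff_hpos (R : realType) k (u v : 'cV[R]_k) :
  (forall i, 0 <= v i 0) -> (forall i, u i 0 != 0 -> v i 0 = 0) ->
  regular_subdiff (@hpos R k) u v.
Proof.
move=> v0 vN e e0.
have H : \forall z \near u, forall i, (0 < u i 0)%R%:R
    + v i 0 * ((z : 'cV[R]_k) i 0 - u i 0) <= (0 < z i 0)%R%:R.
  apply: (@filter_forall _ _ _ (nbhs u)) => i.
  exact: cvg_coord (near_step_subgradient (v0 i) (@vN i)).
apply: filterS H => z H.
rewrite (@le_trans _ _ (hpos u + dotcv v (z - u)))//.
  by rewrite gerBl mulr_ge0 ?sqrtr_ge0// ltW.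
rewrite !hposE -big_split /=; apply: ler_sum => i _.
by rewrite !mxE; exact: H.
Qed.

Lemma limiting_subdiff_hpos (R : realType) k (u v : 'cV[R]_k) :
  (forall i, 0 <= v i 0) -> (forall i, u i 0 != 0 -> v i 0 = 0) ->
  limiting_subdiff (@hpos R k) u v.
Proof.
move=> v0 vN; exists (fun=> u), (fun=> v); split; try exact: cvg_cst.
by move=> _; exact: regular_subdiff_hpos.
Qed.

(** * Thresholds and the proximal inequality *)

Lemma lt_alpha_u (R : realType) m alpha lambda (u : 'cV[R]_m) :
  (alpha%:E < alpha_u lambda u)%E ->
  forall i, 0 < u i 0 -> alpha < u i 0 ^+ 2 / (2 * lambda).
Proof.
rewrite /alpha_u; case: ifPn => [/forallP u0 _ i|_ lt_alpha i ui].
  by rewrite ltNge u0.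
by rewrite -lte_fin (lt_le_trans lt_alpha)// bigmin_le_cond.
Qed.

Lemma lt_alpha_y (R : realType) m alpha lambda (y : 'cV[R]_m) :
  (alpha%:E < alpha_y lambda y)%E ->
  forall i, 0 < y i 0 -> alpha < 2 * lambda / y i 0 ^+ 2.
Proof.
rewrite /alpha_y; case: ifPn => [/forallP y0 _ i|_ lt_alpha i yi].
  by rewrite ltNge y0.
by rewrite -lte_fin (lt_le_trans lt_alpha)// bigmin_le_cond.
Qed.

Lemma prox_hpos (R : realType) m alpha lambda (u y : 'cV[R]_m) :
  0 < alpha -> 0 < lambda ->
  (forall i, 0 <= y i 0) -> (forall i, u i 0 != 0 -> y i 0 = 0) ->
  (alpha%:E < alpha_star lambda u y)%E ->
  prox (alpha * lambda) (@hpos R m) (u + alpha *: y) u.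
Proof.
move=> a0 l0 y0 yN; rewrite /alpha_star lt_min => /andP[].
move=> /lt_alpha_u au /lt_alpha_y ay z.
rewrite !hposE !sqr_enorm !mulr_sumr -!big_split /=; apply: ler_sum => i _.
rewrite !mxE; have al : 0 < alpha * lambda by exact: mulr_gt0.
have [ui|ui|ui] := ltgtP (u i 0) 0.
- rewrite yN ?lt_eqF// !mulr0 addr0 subrr expr0n /= mulr0 add0r.
  by rewrite addr_ge0// mulr_ge0 ?sqr_ge0// ltW.
(* Keeping [u i 0] costs [alpha * lambda]; a competitor [z i 0 <= 0] saves this but pays at least
   [u i 0 ^+ 2 / 2], which is larger below [alpha_u]. *)
- have := au i ui; rewrite ltr_pdivlMr ?mulr_gt0// => lt_u.
  rewrite yN ?gt_eqF// !mulr0 addr0 subrr expr0n /= !mulr0 !mulr1.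
  case: ltP => zi /=; last by nra.
  by have := sqr_ge0 (z i 0 - u i 0); nra.
(* Staying at 0 costs [(alpha * y i 0) ^+ 2 / 2]. A competitor [z i 0 <= 0] is no closer to
   [alpha * y i 0], and a positive one pays at least [alpha * lambda], which is larger below
   [alpha_y] when [y i 0 > 0]. *)
- rewrite ui !add0r sqrrN; have := y0 i; rewrite le_eqVlt => /predU1P[<-|yi].
    rewrite !mulr0 expr0n /= mulr0 addr0.
    by rewrite addr_ge0// mulr_ge0 ?sqr_ge0// ltW.
  have := ay i yi; rewrite ltr_pdivlMr ?exprn_gt0// => lt_y.
  have ayi := mulr_gt0 a0 yi.
  case: ltP => zi /=; last by nra.
  have : alpha * (alpha * y i 0 ^+ 2) < alpha * (2 * lambda) by rewrite ltr_pM2l.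
  by have := sqr_ge0 (z i 0 - alpha * y i 0); nra.
Qed.

Theorem proposition4 (R : realType) (n m : nat) (f : 'cV[R]_n -> R)
  (lambda : R) (A : 'M[R]_(m, n)) (b : 'cV[R]_m)
  (xs : 'cV[R]_n) (us : 'cV[R]_m)
  (f_C1 : continuously_differentiable f)
  (lambda_gt0 : 0 < lambda)
  (locopt : local_minimizer (P_feasible A b) (P_objective f lambda) (xs, us)) :
  local_minimizer (S_feasible A b (nonpos_index us)) (S_objective f) (xs, us)
  /\
  (exists ys : 'cV[R]_m,
     KKT_point f lambda A b xs us ys /\
     (forall alpha : R, 0 < alpha -> (alpha%:E < alpha_star lambda us ys)%E ->
        P_stationary f lambda A b alpha xs us ys)).
Proof.
have locS := local_minimizer_S lambda_gt0 locopt; split=> //.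
have [y [y0 yN grad_y]] := multiplier_S (f_C1.1 xs) locS.
have feas : A *m xs + b - us = 0 by case: locopt => /= -> _; rewrite subrr.
exists y; split=> [|alpha a0 lt_alpha]; split=> //; last exact: prox_hpos.
(* The KKT inclusion scales subgradients by [lambda]; dividing by it preserves signs and support. *)
exists (lambda^-1 *: y); last by rewrite scalerA divff ?gt_eqF// scale1r.
apply: limiting_subdiff_hpos => [i|i /yN yi0]; rewrite mxE.
  by rewrite mulr_ge0 ?invr_ge0// ltW.
by rewrite yi0 mulr0.
Qed.
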